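(* Let $n\ge 1$, let $\varphi_1,\varphi_2,\dots$ be a finite or countably infinite sequence of vectors in $\mathbb{R}^n$, and let $\theta=(\theta_1,\theta_2,\dots)$ be a fixed sequence of real numbers (of the same length). For each $m\ge 1$ let $M_{TM}(m)=[\varphi_1|\cdots|\varphi_m]$, let $B(m)=M_{TM}(m)^+M_{TM}(m)$, let $P(m)=I_m-B(m)$, and let $\theta_{M(m)}=(\theta_1,\dots,\theta_m)\in\mathbb{R}^m$. Then the data insufficiency error contribution $\|P(m)\,\theta_{M(m)}\|_2$ is a nondecreasing function of $m$.
   Context: $X^+$ denotes the Moore--Penrose pseudoinverse of the matrix $X$, $I_m$ is the $m\times m$ identity matrix, and $\|\cdot\|_2$ is the Euclidean norm. $P(m)$ is called the data insufficiency operator of the model consisting of the first $m$ columns. *)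

(* Defs.v *)
From mathcomp Require Import all_boot all_order all_algebra.
From mathcomp Require Import reals.

Set Implicit Arguments.
Unset Strict Implicit.
Unset Printing Implicit Defensive.

Import Order.TTheory GRing.Theory Num.Theory.
Local Open Scope ring_scope.

(* The four Penrose equations; mathcomp's [pinvmx] is only some generalized
   inverse, it does not satisfy the two symmetry conditions. *)
Definition penrose (R : realType) (p q : nat)
    (A : 'M[R]_(p, q)) (X : 'M[R]_(q, p)) : bool :=
  [&& A *m X *m A == A, X *m A *m X == X,
      (A *m X)^T == A *m X & (X *m A)^T == X *m A].

Lemma gram_unitmx (R : realType) (p q : nat) (A : 'M[R]_(p, q)) :
  row_free A -> A *m A^T \in unitmx.
Proof.
move=> freeA; rewrite -row_free_unit -kermx_eq0; apply/eqP/row_matrixP => i.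
rewrite row0; set u := row i _.
have uAA : u *m A *m (u *m A)^T = 0.
  by rewrite trmx_mul mulmxA -(mulmxA u) -row_mul mulmx_ker row0 mul0mx.
apply: (row_free_inj freeA); rewrite mul0mx; apply/rowP => j.
move/matrixP/(_ 0 0): uAA; rewrite !mxE.
under eq_bigr do rewrite [_^T _ _]mxE -expr2.
move=> /psumr_eq0P sq0.
have /eqP := sq0 (fun k _ => sqr_ge0 _) j isT.
by rewrite sqrf_eq0 mxE => /eqP.
Qed.

(* Existence, by full-rank factorization. *)
Lemma penrose_exists (R : realType) (p q : nat) (A : 'M[R]_(p, q)) :
  exists X, penrose A X.
Proof.
have [k [C [B [eA freeC freeB]]]] : exists k (C : 'M_(p, k)) (B : 'M_(k, q)),
    [/\ C *m B = A, row_free C^T & row_free B].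
  exists (\rank A), (col_base A), (row_base A).
  split; [exact: mulmx_base| |exact: row_base_free].
  by rewrite /row_free mxrank_tr; exact: col_base_full.
have uB := gram_unitmx freeB; have := gram_unitmx freeC; rewrite trmxK => uC.
exists (B^T *m invmx (B *m B^T) *m (invmx (C^T *m C) *m C^T)).
set G := invmx (B *m B^T); set H := invmx (C^T *m C).
have sG : G^T = G by rewrite trmx_inv trmx_mul trmxK.
have sH : H^T = H by rewrite trmx_inv trmx_mul trmxK.
have AX : A *m (B^T *m G *m (H *m C^T)) = C *m H *m C^T.
  by rewrite -{1}eA -!mulmxA (mulmxA B) (mulmxA (B *m B^T)) mulmxV // mul1mx.
have XA : B^T *m G *m (H *m C^T) *m A = B^T *m G *m B.
  by rewrite -{1}eA -!mulmxA (mulmxA C^T) (mulmxA H) mulVmx // mul1mx.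
apply/and4P; split; apply/eqP.
- by rewrite AX -eA -!mulmxA (mulmxA C^T) (mulmxA H) mulVmx // mul1mx.
- by rewrite XA -!mulmxA (mulmxA B) (mulmxA (B *m B^T)) mulmxV // mul1mx.
- by rewrite AX !trmx_mul trmxK sH mulmxA.
- by rewrite XA !trmx_mul trmxK sG mulmxA.
Qed.

Lemma penrose_unique (R : realType) (p q : nat) (A : 'M[R]_(p, q))
    (X Y : 'M[R]_(q, p)) :
  penrose A X -> penrose A Y -> X = Y.
Proof.
case/and4P=> /eqP X1 /eqP X2 /eqP X3 /eqP X4.
case/and4P=> /eqP Y1 /eqP Y2 /eqP Y3 /eqP Y4.
have eAX : A *m X = A *m Y.
  rewrite -X3 -{1}Y1 -mulmxA trmx_mul X3 Y3.
  by rewrite mulmxA X1.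
have eXA : X *m A = Y *m A.
  rewrite -X4 -{1}Y1 -mulmxA mulmxA trmx_mul Y4 X4.
  by rewrite -mulmxA (mulmxA A) X1.
by rewrite -X2 eXA -mulmxA eAX mulmxA Y2.
Qed.

Definition mp_pinv (R : realType) (p q : nat) (A : 'M[R]_(p, q)) :
  'M[R]_(q, p) := xchoose (penrose_exists A).

Lemma mp_pinvP (R : realType) (p q : nat) (A : 'M[R]_(p, q)) :
  penrose A (mp_pinv A).
Proof. exact: xchooseP. Qed.

Definition l2norm (R : realType) (m : nat) (v : 'cV[R]_m) : R :=
  Num.sqrt (\sum_(i < m) v i 0 ^+ 2).

(* Sequences are 0-based: [phi j] and [theta j] are the (j+1)-st terms. *)

Definition M_TM (R : realType) (n : nat) (phi : nat -> 'cV[R]_n) (m : nat) :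
  'M[R]_(n, m) := \matrix_(i < n, j < m) phi j i 0.

Definition B_op (R : realType) (n : nat) (phi : nat -> 'cV[R]_n) (m : nat) :
  'M[R]_m := mp_pinv (M_TM phi m) *m M_TM phi m.

Definition P_op (R : realType) (n : nat) (phi : nat -> 'cV[R]_n) (m : nat) :
  'M[R]_m := 1%:M - B_op phi m.

Definition theta_M (R : realType) (theta : nat -> R) (m : nat) : 'cV[R]_m :=
  \col_(j < m) theta j.

(* Length of a finite ([Some N]) or countably infinite ([None]) sequence.  A
   sequence of length [len] is carried by a total function on [nat]; its values
   beyond [len] are never used, as M_TM and theta_M at [m] read only the first
   [m] terms and [m] is required to satisfy [within_length len m]. *)
Definition within_length (len : option nat) (m : nat) : bool :=
  if len is Some N then (m <= N)%N else true.

(* Main.v *)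
Require Import Defs.
From mathcomp Require Import all_boot all_order all_algebra.
From mathcomp Require Import reals.

Set Implicit Arguments.
Unset Strict Implicit.
Unset Printing Implicit Defensive.

Import Order.TTheory GRing.Theory Num.Theory.
Local Open Scope ring_scope.

(** The operator [1 - A^+ A] is the orthogonal projector onto the kernel of
    [A].  Padding with zeros embeds the kernel of the first [m1] columns
    isometrically into the kernel of the first [m2] columns.  Let [x] be the
    longer parameter vector, [w2] its projection onto the larger kernel, and
    [z] the padding of the projection [w1] of the truncation of [x].  Then [z]
    is the orthogonal projection of [w2] onto the padded smaller kernel, so
    Pythagoras gives [|w2|^2 = |w1|^2 + |w2 - z|^2].  This is carried out in
    [l2norm_kproj_le] for an arbitrary isometry [E] in place of the padding;
    the theorem is the case [E = pad_mx]. *)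

Definition kproj (R : realType) (p q : nat) (A : 'M[R]_(p, q)) : 'M[R]_q :=
  1%:M - mp_pinv A *m A.

Section KernelProjector.
Variables (R : realType) (p q : nat) (A : 'M[R]_(p, q)).

Lemma mulmx_kproj : A *m kproj A = 0.
Proof.
have /and4P[/eqP AXA _ _ _] := mp_pinvP A.
by rewrite mulmxBr mulmx1 mulmxA AXA subrr.
Qed.

Lemma kproj_id k (v : 'M_(q, k)) : A *m v = 0 -> kproj A *m v = v.
Proof. by move=> Av0; rewrite mulmxBl mul1mx -mulmxA Av0 mulmx0 subr0. Qed.

(** The symmetry of [A^+ A] makes this projector orthogonal; an arbitrary
    generalized inverse may give an oblique one. *)
Lemma trmx_kproj : (kproj A)^T = kproj A.
Proof.
have /and4P[_ _ _ /eqP symXA] := mp_pinvP A.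
by rewrite linearB /= trmx1 symXA.
Qed.

(** The projector is self-adjoint and fixes the kernel, so it can be moved to
    the other side of the inner product and absorbed there. *)
Lemma dot_kproj k l (v : 'M_(q, k)) (x : 'M_(q, l)) :
  A *m v = 0 -> v^T *m (kproj A *m x) = v^T *m x.
Proof.
by move=> Av0; rewrite mulmxA -{1}trmx_kproj -trmx_mul kproj_id.
Qed.

End KernelProjector.

Lemma l2normE (R : realType) (m : nat) (v : 'cV[R]_m) :
  l2norm v = Num.sqrt ((v^T *m v) 0 0).
Proof.
by congr Num.sqrt; rewrite !mxE; apply: eq_bigr => i _; rewrite mxE expr2.
Qed.

Lemma dot_ge0 (R : realType) (m : nat) (v : 'cV[R]_m) : 0 <= (v^T *m v) 0 0.
Proof. by rewrite mxE sumr_ge0 // => i _; rewrite mxE -expr2 sqr_ge0. Qed.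

(** [E] embeds the kernel of [A *m E] isometrically into the kernel of [A], and
    [E^T *m x] has the same inner products with the former as [x] has with its
    image; projecting onto the smaller of two nested subspaces gives the
    shorter vector. *)
Lemma l2norm_kproj_le (R : realType) (p q r : nat) (A : 'M[R]_(p, q))
    (E : 'M[R]_(q, r)) (x : 'cV[R]_q) :
  E^T *m E = 1%:M ->
  l2norm (kproj (A *m E) *m (E^T *m x)) <= l2norm (kproj A *m x).
Proof.
move=> isoE; rewrite !l2normE; apply: ler_wsqrtr.
set w1 := kproj (A *m E) *m _; set w2 := kproj A *m x; pose z := E *m w1.
have AEw1 : A *m E *m w1 = 0 by rewrite mulmxA mulmx_kproj mul0mx.
have Az : A *m z = 0 by rewrite mulmxA.
have zz : z^T *m z = w1^T *m w1.
  by rewrite trmx_mul -mulmxA (mulmxA E^T) isoE mul1mx.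
have zw2 : z^T *m w2 = w1^T *m w1.
  by rewrite dot_kproj // trmx_mul -mulmxA [RHS]dot_kproj.
have w2z : w2^T *m z = w1^T *m w1.
  by rewrite -[LHS]trmxK trmx_mul trmxK zw2 trmx_mul trmxK.
have pyth : (w2 - z)^T *m (w2 - z) = w2^T *m w2 - w1^T *m w1.
  by rewrite mulmxBr [(w2 - z)^T]linearB /= !mulmxBl zz zw2 w2z subrr subr0.
by rewrite -subr_ge0; have := dot_ge0 (w2 - z); rewrite pyth !mxE.
Qed.

(** The map appending [m2 - m1] zero entries; its transpose truncates. *)
Definition pad_mx (R : realType) (m2 m1 : nat) : 'M[R]_(m2, m1) :=
  \matrix_(i, j) (i == j :> nat)%:R.

Lemma mulmx_padE (R : realType) (m1 m2 : nat) (le12 : (m1 <= m2)%N)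
    (p : nat) (A : 'M[R]_(p, m2)) (i : 'I_p) (j : 'I_m1) :
  (A *m pad_mx R m2 m1) i j = A i (widen_ord le12 j).
Proof.
rewrite mxE (bigD1 (widen_ord le12 j)) //= mxE eqxx mulr1 big1 ?addr0 // => k.
by rewrite mxE -val_eqE /= => /negPf->; rewrite mulr0.
Qed.

Lemma pad_mx_isometry (R : realType) (m1 m2 : nat) : (m1 <= m2)%N ->
  (pad_mx R m2 m1)^T *m pad_mx R m2 m1 = 1%:M.
Proof.
move=> le12; apply/matrixP => i j.
by rewrite (mulmx_padE le12) !mxE /= eq_sym val_eqE.
Qed.

Lemma M_TM_pad (R : realType) (n : nat) (phi : nat -> 'cV[R]_n)
    (m1 m2 : nat) : (m1 <= m2)%N ->
  M_TM phi m2 *m pad_mx R m2 m1 = M_TM phi m1.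
Proof.
by move=> le12; apply/matrixP => i j; rewrite (mulmx_padE le12) !mxE.
Qed.

Lemma theta_M_pad (R : realType) (theta : nat -> R) (m1 m2 : nat) :
  (m1 <= m2)%N ->
  (pad_mx R m2 m1)^T *m theta_M theta m2 = theta_M theta m1.
Proof.
move=> le12; apply: trmx_inj; rewrite trmx_mul trmxK.
by apply/matrixP => i j; rewrite (mulmx_padE le12) !mxE.
Qed.

Theorem mainTheorem2 (R : realType) (n : nat) (hn : (1 <= n)%N)
    (len : option nat) (phi : nat -> 'cV[R]_n) (theta : nat -> R) :
  forall m1 m2 : nat,
    (1 <= m1)%N -> (m1 <= m2)%N -> within_length len m2 ->
    l2norm (P_op phi m1 *m theta_M theta m1)
      <= l2norm (P_op phi m2 *m theta_M theta m2).
Proof.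
move=> m1 m2 _ le12 _.
have := l2norm_kproj_le (M_TM phi m2) (theta_M theta m2)
  (pad_mx_isometry R le12).
by rewrite M_TM_pad // theta_M_pad.
Qed.
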